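(* Let $R=\mathbb F_2^8$. The number of binary operations $\circ$ on $R$, different from $+$, such that $(R,+,\circ)$ is a binary bibrace with $+$ the standard addition of $\mathbb F_2^8$ (equivalently, the number of binary alternating algebra structures $(R,+,\cdot)$ with nonzero product on the vector space $R$) is exactly $$117\,833\,335\,446\,015.$$
   Context: A binary bibrace is a triple $(R,+,\circ)$ where $(R,+)$ and $(R,\circ)$ are elementary abelian $2$-groups and, for all $x,y,z\in R$, $$(x+y)\circ z=x\circ z+z+y\circ z,\qquad (x\circ y)+z=(x+z)\circ z\circ(y+z).$$ A binary alternating algebra is an $\mathbb F_2$-algebra $(R,+,\cdot)$ (bilinear product) with $x\cdot x=0$ and $x\cdot y\cdot z=0$ for all $x,y,z\in R$. The two structures correspond to each other via $x\circ y=x+y+x\cdot y$ and $x\cdot y=x+y+x\circ y$; the zero product corresponds to $\circ=+$. Operations are counted as distinct operations on the set $R$, not up to isomorphism. *)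

(* Defs.v *)
From mathcomp Require Import all_boot all_algebra.
From mathcomp Require Import boolp.

Set Implicit Arguments.
Unset Strict Implicit.
Unset Printing Implicit Defensive.

Import GRing.Theory.
Local Open Scope ring_scope.

Definition elementary_abelian2 (T : Type) (op : T -> T -> T) : Prop :=
  exists (e : T) (inv : T -> T),
    [/\ associative op, commutative op, left_id e op, left_inverse e inv op
      & forall x, op x x = e].

Definition binary_bibrace (T : Type) (add circ : T -> T -> T) : Prop :=
  [/\ elementary_abelian2 add,
      elementary_abelian2 circ,
      forall x y z, circ (add x y) z = add (add (circ x z) z) (circ y z)
    & forall x y z, add (circ x y) z = circ (circ (add x z) z) (add y z)].

(* Products are left-normed: x . y . z is (x . y) . z; the other bracketing
   vanishes as well, because an alternating bilinear product over F_2 is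
   commutative. *)
Definition binary_alternating_algebra (V : lmodType 'F_2)
    (mul : V -> V -> V) : Prop :=
  [/\ forall z, linear (fun x => mul x z),
      forall x, linear (fun y => mul x y),
      forall x, mul x x = 0
    & forall x y z, mul (mul x y) z = 0].

(* Binary operations on a finite type are counted as elements of the finite
   type {ffun T * T -> T}, hence up to pointwise equality and not up to
   isomorphism. *)
Definition nb_binops (T : finType) (P : (T -> T -> T) -> Prop) : nat :=
  #|[set f : {ffun T * T -> T} | `[< P (fun x y => f (x, y)) >]]|.

(* Main.v *)
Require Import Defs.
From Stdlib Require Import BinNat BinInt Znat Lia.
From mathcomp Require Import all_boot all_algebra.
From mathcomp Require Import boolp ring ssrZ.

(* An alternating algebra is an alternating bilinear map whose values span a
   subspace of its radical.  Summing over the possible radicals K, and removing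
   the requirement that the radical be exactly K by Moebius inversion over the
   subspaces U containing K, reduces the count to the alternating bilinear maps
   that vanish on U and take values in K: there are
   2 ^ (dim K * 'C(8 - dim U, 2)) of them.  Subspaces are replaced by their
   bases, that is by full-rank matrices, at the cost of dividing by the orders
   of general linear groups.  Bibraces are transported to algebras by the
   involution f |-> x + y + f x y. *)

Set Implicit Arguments.
Unset Strict Implicit.
Unset Printing Implicit Defensive.

Import GRing.Theory.
Local Open Scope ring_scope.
Local Delimit Scope Z_scope with coqZ.

(** * Counting full-rank matrices inside a row space *)

Section Frames.
Variables (F : finFieldType) (n : nat).
Local Notation q := #|F|.

Lemma card_submx m (D : 'M[F]_(m, n)) :
  #|[set v : 'rV_n | (v <= D)%MS]| = (q ^ \rank D)%N.
Proof.
rewrite -[\rank D]mul1n -card_mx.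
pose h (u : 'rV_(\rank D)) := u *m row_base D.
have hK : cancel h (mulmx^~ (pinvmx (row_base D))).
  by move=> u; rewrite /h mulmxKp ?row_base_free.
rewrite -(card_imset _ (can_inj hK)) ; apply: eq_card => v.
rewrite inE -(eq_row_base D); apply/idP/imsetP => [/submxP[u ->]|[u _ ->]].
  by exists u.
exact: submxMl.
Qed.

Lemma mxrank_adds_rV m (A : 'M[F]_(m, n)) (v : 'rV_n) :
  \rank (A + v)%MS = (\rank A + ~~ (v <= A)%MS)%N.
Proof.
case: (boolP (v <= A)%MS) => [/addsmx_idPl -> | vA]; first by rewrite addn0.
apply/eqP; rewrite eqn_leq; apply/andP; split.
  by rewrite (leq_trans (mxrank_adds_leqif A v)) // leq_add2l rank_leq_row.
rewrite addn1 (ltn_leqif (mxrank_leqif_sup (addsmxSl A v))).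
by rewrite addsmx_sub submx_refl.
Qed.

(** The rows of [B] are chosen one at a time: each must lie in [D] and avoid the span of [A] and the
    earlier rows. If [D] has too little room, some factor is 0, as it should be. *)
Lemma card_frame_ext m1 m2 j (A : 'M[F]_(m1, n)) (D : 'M_(m2, n)) :
    (A <= D)%MS ->
  #|[set B : 'M_(j, n) | (B <= D)%MS && (\rank (A + B)%MS == \rank A + j)%N]|
  = \prod_(i < j) (q ^ \rank D - q ^ (\rank A + i))%N.
Proof.
elim: j m1 A => [|j IHj] m1 A sAD.
  rewrite big_ord0 -[RHS](cards1 (0 : 'M[F]_(0, n))).
  apply: eq_card => B; rewrite !inE [B]flatmx0 eqxx sub0mx /=.
  by rewrite addsmx0 addn0 eqxx.
rewrite -sum1dep_card.
rewrite (reindex (fun p : 'rV[F]_n * 'M_(j, n) => col_mx p.1 p.2)) /=; last first.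
  exists (fun B : 'M_(1 + j, n) => (usubmx B, dsubmx B)) => [[v B] _|B _] /=.
    by rewrite col_mxKu col_mxKd.
  by rewrite vsubmxK.
rewrite (eq_bigl (fun p => ((p.1 <= D)%MS && ~~ (p.1 <= A)%MS) &&
    ((p.2 <= D)%MS && (\rank ((A + p.1) + p.2)%MS == \rank (A + p.1)%MS + j)%N))).
  rewrite -(pair_big_dep (fun v => (v <= D)%MS && ~~ (v <= A)%MS)
    (fun v B => (B <= D)%MS && (\rank ((A + v) + B)%MS == \rank (A + v)%MS + j)%N)
    (fun _ _ => 1%N)) /=.
  rewrite big_ord_recl /= addn0.
  under eq_bigr => v /andP[vD vA].
    rewrite sum1dep_card IHj ?addsmx_sub ?sAD //.
    under eq_bigr => i _ do rewrite mxrank_adds_rV vA /= -addnA.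
    over.
  rewrite sum_nat_const; congr (_ * _)%N.
  rewrite -!card_submx -cardsDS.
    by apply: eq_card => v; rewrite !inE andbC.
  by apply/subsetP => v; rewrite !inE => /submx_trans->.
move=> [v B] /=; pose vB : 'M_(1 + j, n) := col_mx v B.
rewrite -[LHS]/((vB <= D)%MS && (\rank (A + vB)%MS == \rank A + j.+1)%N).
rewrite {}/vB col_mx_sub -!andbA; apply: andb_id2l => vD.
rewrite andbCA; apply: andb_id2l => BD.
have -> : \rank (A + col_mx v B)%MS = \rank ((A + v) + B)%MS.
  by rewrite -addsmxA (adds_eqmx (eqmx_refl A) (addsmxE v B)).
(* A first row already in [A] is excluded: the [j] other rows raise the rank by at most [j], short
   of the required [j.+1]. *)
rewrite mxrank_adds_rV; case: (boolP (v <= A)%MS) => vA /=; last by rewrite -addnA.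
apply/eqP => rE; have := leq_trans (mxrank_adds_leqif (A + v)%MS B)
  (leq_add (leqnn _) (rank_leq_row B)).
by rewrite rE mxrank_adds_rV vA addn0 leq_add2l ltnn.
Qed.
End Frames.

(** * Alternating bilinear maps with prescribed kernel and image constraints *)

Section Alternating.
Variables (F : finFieldType) (n p : nat).
Local Notation q := #|F|.
Local Notation V := 'rV[F]_n.

Definition alternating_bilinear (mul : V -> V -> 'rV[F]_p) : Prop :=
  [/\ forall z, linear (fun x => mul x z),
      forall x, linear (mul x)
    & forall x, mul x x = 0].

Section AlternatingTheory.
Variable mul : V -> V -> 'rV[F]_p.
Hypothesis mulP : alternating_bilinear mul.

Lemma altDl x y z : mul (x + y) z = mul x z + mul y z.
Proof. by case: mulP => /(_ z) h _ _; have:= h 1 x y; rewrite !scale1r. Qed.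
Lemma altDr x y z : mul x (y + z) = mul x y + mul x z.
Proof. by case: mulP => _ /(_ x) h _; have:= h 1 y z; rewrite !scale1r. Qed.
Lemma alt0l z : mul 0 z = 0.
Proof. by apply: (addrI (mul 0 z)); rewrite -altDl !addr0. Qed.
Lemma alt0r z : mul z 0 = 0.
Proof. by apply: (addrI (mul z 0)); rewrite -altDr !addr0. Qed.
Lemma altZl a x z : mul (a *: x) z = a *: mul x z.
Proof.
by case: mulP => /(_ z) h _ _; have:= h a x 0; rewrite alt0l !addr0.
Qed.
Lemma altZr a x z : mul z (a *: x) = a *: mul z x.
Proof.
by case: mulP => _ /(_ z) h _; have:= h a x 0; rewrite alt0r !addr0.
Qed.
Lemma altxx x : mul x x = 0. Proof. by case: mulP. Qed.
Lemma altC x y : mul x y = - mul y x.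
Proof.
apply/eqP; rewrite -addr_eq0; have := altxx (x + y).
by rewrite altDl !altDr !altxx add0r addr0 => ->.
Qed.
Lemma alt_suml I r (P : pred I) (G : I -> V) z :
  mul (\sum_(i <- r | P i) G i) z = \sum_(i <- r | P i) mul (G i) z.
Proof. exact: (big_morph (mul^~ z) (fun x y => altDl x y z) (alt0l z)). Qed.
Lemma alt_sumr I r (P : pred I) (G : I -> V) z :
  mul z (\sum_(i <- r | P i) G i) = \sum_(i <- r | P i) mul z (G i).
Proof. exact: (big_morph (mul z) (altDr z) (alt0r z)). Qed.

(** In the bilinear expansion the diagonal terms vanish, and antisymmetry folds the terms with
    [t.2 < t.1] onto those with [t.1 < t.2]. *)
Lemma alt_mulmx l (u v : 'rV_l) (M : 'M_(l, n)) :
  mul (u *m M) (v *m M) =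
  \sum_(t : 'I_l * 'I_l | (t.1 < t.2)%N)
     (u 0 t.1 * v 0 t.2 - u 0 t.2 * v 0 t.1) *: mul (row t.1 M) (row t.2 M).
Proof.
rewrite !mulmx_sum_row alt_suml.
under eq_bigr => i _.
  rewrite alt_sumr.
  under eq_bigr => j _ do rewrite altZl altZr scalerA.
  over.
rewrite pair_big /=.
rewrite (bigID (fun t : 'I_l * 'I_l => (t.1 < t.2)%N)) /=.
rewrite [X in _ + X](bigID (fun t : 'I_l * 'I_l => (t.2 < t.1)%N)) /=.
rewrite [X in _ + (_ + X)]big1 ?addr0; last first.
  move=> [i j] /=; rewrite -!leqNgt -eqn_leq => /eqP/val_inj ->.
  by rewrite altxx scaler0.
under [RHS]eq_bigr do rewrite scalerBl.
rewrite sumrB; congr (_ + _).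
rewrite (reindex_inj (h := fun t : 'I_l * 'I_l => (t.2, t.1))) /=; last first.
  by move=> [a b] [c d] [-> ->].
rewrite -sumrN; apply: eq_big => [[i j]|[i j] _] /=.
  by case: ltngtP.
by rewrite altC scalerN.
Qed.

End AlternatingTheory.

Lemma card_ltn_pairs l :
  #|[pred t : 'I_l * 'I_l | (t.1 < t.2)%N]| = 'C(l, 2).
Proof.
rewrite -sum1_card -(pair_big_dep xpredT (fun i j : 'I_l => (i < j)%N)
   (fun _ _ => 1%N)) /= (exchange_big_dep xpredT) //= -bin2_sum big_mkord.
apply: eq_bigr => j _.
rewrite -[RHS](card_ord j) -sum1_card.
by rewrite (big_ord_narrow (ltnW (ltn_ord j))).
Qed.

(* A complement of the row space of [C] is spanned by the rows of [M], and
   [N] reads coordinates with respect to them, modulo [C]. *)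
Lemma complement_coordinates m (C : 'M[F]_(m, n)) :
  exists (M : 'M[F]_(n - \rank C, n)) (N : 'M[F]_(n, n - \rank C)),
  [/\ M *m N = 1%:M, C *m N = 0 & forall x : V, (x - x *m N *m M <= C)%MS].
Proof.
rewrite -mxrank_compl; set M := row_base C^C%MS.
pose P := proj_mx C^C%MS <<C>>%MS.
have cap0 : (C^C :&: <<C>>)%MS = 0.
  by apply/eqP; rewrite -submx0 capmxC (cap_eqmx (genmxE C) (eqmx_refl _)) capmx_compl.
exists M, (P *m pinvmx M); split.
- by rewrite mulmxA proj_mx_id ?mulmxVp ?row_base_free // eq_row_base.
- by rewrite mulmxA proj_mx_0 ?mul0mx // genmxE.
move=> x; rewrite (mulmxA x) mulmxKpV ?eq_row_base ?proj_mx_sub //.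
rewrite -(genmxE C) proj_mx_compl_sub // addsmxC (adds_eqmx (genmxE C) (eqmx_refl _)).
by rewrite submx_full // addsmx_compl_full.
Qed.

Definition alt_maps k m (A : 'M[F]_(k, p)) (C : 'M[F]_(m, n)) :=
  [set f : {ffun V * V -> 'rV[F]_p} |
    `[< [/\ alternating_bilinear (fun x y => f (x, y)),
            forall x y, (x <= C)%MS -> f (x, y) = 0
          & forall x y, (f (x, y) <= A)%MS] >]].

(** Such a map factors through the quotient by [C], so it amounts to a free choice of a vector in
    the span of [A] for each pair of distinct elements of a basis of that quotient. *)
Lemma card_alt_maps k m (A : 'M[F]_(k, p)) (C : 'M[F]_(m, n)) :
  #|alt_maps A C| = (q ^ (\rank A * 'C(n - \rank C, 2)))%N.
Proof.
have [M [N [MN CN NM]]] := complement_coordinates C.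
set l := (n - \rank C)%N in M N MN CN NM *.
pose A' := row_base A.
pose D := [pred t : 'I_l * 'I_l | (t.1 < t.2)%N].
pose form (g : {ffun 'I_l * 'I_l -> 'rV[F]_(\rank A)}) (u v : 'rV_l) :=
  \sum_(t | t \in D) (u 0 t.1 * v 0 t.2 - u 0 t.2 * v 0 t.1) *: g t.
pose h g := [ffun s : V * V => form g (s.1 *m N) (s.2 *m N) *m A'].
(* On two basis vectors the 2 by 2 minors all vanish except the one indexed by [(a, b)], so [form]
   recovers its coefficients. *)
have formE g (a b : 'I_l) : (a < b)%N -> form g (row a M *m N) (row b M *m N) = g (a, b).
  move=> ab; rewrite /form -!row_mul MN.
  rewrite (bigD1 (a, b)) //= !mxE !eqxx [b == a]eq_sym.
  rewrite (ltn_eqF ab : (a == b) = false) mulr0 subr0 mulr1 scale1r.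
  rewrite big1 ?addr0 // => [[c d] /andP[/= cd nab]]; rewrite !mxE.
  suff -> : (a == c)%:R * (b == d)%:R - (a == d)%:R * (b == c)%:R = 0 :> F.
    by rewrite scale0r.
  rewrite -!natrM !mulnb.
  have -> : (a == c) && (b == d) = false.
    by apply/negbTE; rewrite [a == _]eq_sym [b == _]eq_sym.
  have -> : (a == d) && (b == c) = false.
    by apply/negP => /andP[/eqP ad /eqP bc]; move: ab; rewrite ad bc ltnNge ltnW.
  by rewrite subrr.
(* Coefficient families are required to be 0 off [D]; otherwise [h], which only sees [D], would not
   be injective. *)
have -> : alt_maps A C = h @: [set g in pffun_on 0 D predT].
  apply/setP => f; rewrite inE; apply/asboolP/imsetP => [[fP fC fA]|[g _ ->]].
  - exists [ffun t : 'I_l * 'I_l => if t \in D then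
        f (row t.1 M, row t.2 M) *m pinvmx A' else 0].
      rewrite inE; apply/pffun_onP; split=> [|? _]; last by [].
      by apply/subsetP => t; rewrite inE ffunE; case: ifP; rewrite // eqxx.
    apply/ffunP => -[x y]; rewrite ffunE /=.
    (* [z] and its projection [z *m N *m M] differ by an element of [C], on which [f] vanishes. *)
    have fN z w : f (z, w) = f (z *m N *m M, w).
      have /= := altDl fP (z - z *m N *m M) (z *m N *m M) w.
      by rewrite subrK (fC (_ - _)) ?add0r.
    have -> : f (x, y) = f (x *m N *m M, y *m N *m M).
      by rewrite fN (altC fP) fN -(altC fP).
    rewrite (alt_mulmx fP) /form mulmx_suml; apply: eq_bigr => t tD.
    by rewrite -scalemxAl ffunE inE tD mulmxKpV // eq_row_base.
  - have formM : alternating_bilinear (fun x y => h g (x, y)).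
      split=> [z a x y|x a y z|x]; rewrite !ffunE /=.
      + rewrite scalemxAl -mulmxDl; congr (_ *m _).
        rewrite /form scaler_sumr -big_split; apply: eq_bigr => t _ /=.
        rewrite scalerA -scalerDl mulmxDl -scalemxAl; congr (_ *: _).
        by move: (x *m N) (y *m N) => u v; rewrite !mxE; ring.
      + rewrite scalemxAl -mulmxDl; congr (_ *m _).
        rewrite /form scaler_sumr -big_split; apply: eq_bigr => t _ /=.
        rewrite scalerA -scalerDl mulmxDl -scalemxAl; congr (_ *: _).
        by move: (y *m N) (z *m N) => u v; rewrite !mxE; ring.
      + rewrite /form big1 ?mul0mx // => t _.
        by rewrite [X in _ - X]mulrC subrr scale0r.
    split=> // x y.
      case/submxP=> c ->; rewrite ffunE /= -mulmxA CN mulmx0 /form big1 ?mul0mx //.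
      by move=> t _; rewrite !mxE !mul0r subrr scale0r.
    by rewrite ffunE mulmx_sub // eq_row_base.
rewrite card_in_imset; last first.
  move=> g1 g2; rewrite !inE => /pffun_onP[/subsetP g1D _] /pffun_onP[/subsetP g2D _] eqh.
  apply/ffunP => t; case: (boolP (t \in D)) => tD; last first.
    have /eqP -> : g1 t == 0 by apply: contraNT tD => /g1D.
    by apply/esym/eqP; apply: contraNT tD => /g2D.
  have := congr1 (fun f : {ffun _ -> _} => f (row t.1 M, row t.2 M)) eqh.
  rewrite !ffunE /= !formE // -surjective_pairing.
  by apply/row_free_inj/row_base_free.
by rewrite cardsE card_pffun_on card_mx mul1n card_ltn_pairs -expnM.
Qed.
End Alternating.

(** * Radicals, double counting of flags, and Moebius inversion *)

Section Algebras.
Variables (F : finFieldType) (n : nat).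
Local Notation q := #|F|.
Local Notation V := 'rV[F]_n.
Implicit Type f : {ffun V * V -> V}.

(** Taking a span yields a subspace for every [f]; for bilinear [f] it adds no vector to the set of
    those annihilating everything. *)
Definition radical f : 'M[F]_n :=
  (\sum_(v : V | [forall y, f (v, y) == 0]) <<v>>)%MS.

Definition alternating_maps : {set {ffun V * V -> V}} :=
  [set f : {ffun V * V -> V} | `[< alternating_bilinear (fun x y => f (x, y)) >]].

Definition alternating_algebras : {set {ffun V * V -> V}} :=
  [set f : {ffun V * V -> V} in alternating_maps |
    [forall x, forall y, forall z, f (f (x, y), z) == 0]].

Lemma sub_radical f m (A : 'M_(m, n)) : f \in alternating_maps ->
  reflect (forall x y, (x <= A)%MS -> f (x, y) = 0) (A <= radical f)%MS.
Proof.
rewrite inE => /asboolP fP.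
have radP (v : V) : (v <= radical f)%MS -> forall y, f (v, y) = 0.
  case/sub_sumsmxP => u -> y; rewrite (alt_suml fP) big1 // => w /forallP w0.
  have : (u w *m <<w>> <= w)%MS by rewrite mulmx_sub // genmxE.
  by case/sub_rVP => a ->; rewrite (altZl fP) (eqP (w0 y)) scaler0.
apply: (iffP idP) => [Ar x y xA | A0]; first by rewrite radP ?(submx_trans xA).
apply/row_subP => i; apply: (submx_trans _ (sumsmx_sup (row i A) _ (submx_refl _))).
  by rewrite genmxE.
by apply/forallP => y; rewrite A0 ?row_sub.
Qed.

Definition radical_frames k f : {set 'M[F]_(k, n)} :=
  [set A : 'M_(k, n) | [&& \rank A == k, (A <= radical f)%MS
    & [forall x, forall y, (f (x, y) <= A)%MS]]].

(** [P.1] is a basis of the subspace K, and [P.2] extends it to a basis of an intermediate subspace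
    U between K and the radical. *)
Definition radical_frame_pairs k j f : {set 'M[F]_(k, n) * 'M[F]_(j, n)} :=
  [set P : 'M_(k, n) * 'M_(j, n) | (P.1 \in radical_frames k f) &&
     ((P.2 <= radical f)%MS && (\rank (P.1 + P.2)%MS == k + j)%N)].

Lemma card_radical_frame_pairs k j f :
  #|radical_frame_pairs k j f| =
  (#|radical_frames k f| * \prod_(i < j) (q ^ \rank (radical f) - q ^ (k + i)))%N.
Proof.
rewrite -sum1dep_card -(pair_big_dep (mem (radical_frames k f)) (fun A B =>
  (B <= radical f)%MS && (\rank (A + B)%MS == k + j)%N) (fun _ _ => 1%N)) /=.
rewrite -sum_nat_const; apply: eq_bigr => A.
rewrite inE => /and3P[/eqP rA Ar _].
by have := card_frame_ext j Ar; rewrite rA sum1dep_card.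
Qed.

Lemma radical_frames_rank k f A : A \in radical_frames k f ->
  (k <= \rank (radical f))%N.
Proof. by rewrite inE => /and3P[/eqP rA /mxrankS]; rewrite rA. Qed.

Lemma card_frames k m (D : 'M[F]_(m, n)) :
  #|[set A : 'M_(k, n) | (A <= D)%MS && (\rank A == k)]| =
  \prod_(i < k) (q ^ \rank D - q ^ i)%N.
Proof.
have := @card_frame_ext F n 0 m k 0 D (sub0mx _ _).
under eq_bigr => i _ do rewrite mxrank0 add0n.
move=> <-; apply: eq_card => A; rewrite !inE; congr (_ && _).
by rewrite adds0mx mxrank0.
Qed.

(** In top dimension a frame must span the radical itself, so the image condition says that products
    lie in the radical, that is, that triple products vanish. Hence either all bases of the radical
    qualify or none does. *)
Lemma card_radical_frames_max f : f \in alternating_maps ->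
  #|radical_frames (\rank (radical f)) f| = ((f \in alternating_algebras) *
  \prod_(i < \rank (radical f)) (q ^ \rank (radical f) - q ^ i))%N.
Proof.
move=> fA; have /sub_radical -/(_ fA) radP := submx_refl (radical f).
case: (boolP (f \in _)) => [|fN].
  rewrite inE fA /= => /forallP f0; rewrite mul1n -card_frames.
  apply: eq_card => A; rewrite !inE andbA andbC [X in _ && X]andbC.
  case: (boolP (A <= radical f)%MS) => sAr; rewrite ?andbF //=.
  case: eqP => [rA|]; rewrite ?andbF // andbT.
  apply/forallP => x; apply/forallP => y.
  (* Equal ranks turn the inclusion of [A] in the radical into equality of spans. *)
  have [_ /esym] := mxrank_leqif_sup sAr; rewrite rA eqxx.
  apply: submx_trans; apply/(sub_radical _ fA) => u z.
  case/sub_rVP=> a ->; move: (fA); rewrite inE => /asboolP fP.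
  rewrite (altZl fP).
  by have /forallP/(_ y)/forallP/(_ z)/eqP-> := f0 x; rewrite scaler0.
rewrite mul0n; apply/eqP; rewrite cards_eq0 -subset0; apply/subsetP => A.
rewrite inE => /and3P[/eqP rA sAr /forallP imA]; case/negP: fN.
rewrite inE fA /=; apply/forallP => x; apply/forallP => y; apply/forallP => z.
rewrite radP // (submx_trans _ sAr) //.
by have /forallP := imA x; apply.
Qed.

Lemma alt_maps_radical k j (A : 'M[F]_(k, n)) (B : 'M[F]_(j, n)) :
    \rank A = k -> \rank (A + B)%MS = (k + j)%N ->
  [set f in alternating_maps | (A, B) \in radical_frame_pairs k j f]
  = alt_maps A (A + B)%MS.
Proof.
move=> rA rAB; apply/setP => f; rewrite !inE /= rA rAB !eqxx andbT /= -andbA.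
apply/andP/asboolP => [[/asboolP fP /and3P[Ar /forallP imA Br]] | [fP fAB fA]].
  have fA : f \in alternating_maps by rewrite inE; apply/asboolP.
  split=> // [|x y]; last by have /forallP := imA x; apply.
  by apply/(sub_radical _ fA); rewrite addsmx_sub Ar.
have falt : f \in alternating_maps by rewrite inE; apply/asboolP.
split; first exact/asboolP.
have := introT (sub_radical _ falt) fAB.
rewrite addsmx_sub => /andP[-> ->]; rewrite andbT.
by apply/forallP => x; apply/forallP => y.
Qed.

(** Double counting: for a fixed pair [(A, B)] the admissible [f] are those of [alt_maps], whose
    number depends only on [k] and [j]. *)
Lemma sum_radical_frame_pairs k j :
  (\sum_(f in alternating_maps) #|radical_frame_pairs k j f| =
  \prod_(i < k) (q ^ n - q ^ i) * \prod_(i < j) (q ^ n - q ^ (k + i))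
    * q ^ (k * 'C(n - (k + j), 2)))%N.
Proof.
under eq_bigr => f _ do rewrite -sum1_card.
rewrite (exchange_big_dep (fun P : 'M_(k, n) * 'M_(j, n) =>
  (\rank P.1 == k) && (\rank (P.1 + P.2)%MS == k + j)%N)) /=; last first.
  by move=> f [A B] _; rewrite !inE => /andP[/and3P[-> _ _] /andP[_ ->]].
rewrite (eq_bigr (fun=> q ^ (k * 'C(n - (k + j), 2)))%N); last first.
  move=> [A B] /= /andP[/eqP rA /eqP rAB]; rewrite sum1dep_card.
  by rewrite alt_maps_radical // card_alt_maps rA rAB.
rewrite -(pair_big_dep (fun A : 'M_(k, n) => \rank A == k)
  (fun A (B : 'M_(j, n)) => (\rank (A + B)%MS == k + j)%N)
  (fun _ _ => q ^ (k * 'C(n - (k + j), 2)))%N) /=.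
rewrite (eq_bigr (fun=> \prod_(i < j) (q ^ n - q ^ (k + i))
   * q ^ (k * 'C(n - (k + j), 2))))%N => [|A /eqP rA]; last first.
  have := card_frame_ext j (submx1 A); rewrite mxrank1 rA => <-.
  rewrite -sum_nat_const; apply: eq_bigl => B.
  by rewrite inE submx1.
have := card_frames k (1%:M : 'M[F]_n); rewrite mxrank1 => <-.
rewrite sum_nat_const mulnA; congr (_ * _ * _)%N.
by apply: eq_card => A; rewrite inE submx1.
Qed.

(* For a fixed [f] with radical of dimension [r], the number of pairs is
   nonzero only for [k <= r]; the weights [c k j] realise Moebius inversion on
   the subspaces between the span of [A] and the radical, so that only the
   terms in which [A] spans the radical survive. *)
Lemma card_alternating_algebras (R : comNzRingType) (b : nat) (M : R) (c : nat -> nat -> R) :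
    q = b ->
    (forall k r, (k < r <= n)%N ->
       \sum_(0 <= j < n.+1 - k)
          c k j * (\prod_(i < j) (b ^ r - b ^ (k + i)))%N%:R = 0) ->
    (forall k, (k <= n)%N ->
       (\sum_(0 <= j < n.+1 - k)
          c k j * (\prod_(i < j) (b ^ k - b ^ (k + i)))%N%:R)
       * (\prod_(i < k) (b ^ k - b ^ i))%N%:R = M) ->
  M * #|alternating_algebras|%:R =
  \sum_(0 <= k < n.+1) \sum_(0 <= j < n.+1 - k) c k j *
    (\prod_(i < k) (b ^ n - b ^ i) * \prod_(i < j) (b ^ n - b ^ (k + i))
    * b ^ (k * 'C(n - (k + j), 2)))%N%:R.
Proof.
move=> <- c_lt c_eq.
have weight f : f \in alternating_maps ->
    \sum_(0 <= k < n.+1) \sum_(0 <= j < n.+1 - k)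
      c k j * #|radical_frame_pairs k j f|%:R
    = M * (f \in alternating_algebras)%:R.
  move=> fA; set r := \rank (radical f).
  have rn : (r <= n)%N by apply: rank_leq_row.
  have fac k : \sum_(0 <= j < n.+1 - k) c k j * #|radical_frame_pairs k j f|%:R
      = #|radical_frames k f|%:R * \sum_(0 <= j < n.+1 - k)
          c k j * (\prod_(i < j) (q ^ r - q ^ (k + i)))%N%:R.
    rewrite mulr_sumr; apply: eq_bigr => j _.
    by rewrite card_radical_frame_pairs natrM mulrCA.
  (* Only [k = r] survives: smaller [k] cancel by [c_lt], and larger [k] admit no frame in the
     radical. *)
  rewrite big_mkord (bigD1 (Ordinal (rn : (r < n.+1)%N))) //= [X in _ + X]big1 ?addr0 => [|k kr].
    rewrite fac card_radical_frames_max // natrM -mulrA [X in _ * X]mulrC.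
    by rewrite c_eq // mulrC.
  rewrite fac; case: (ltngtP k r) => [kr'|rk|rk].
  - by rewrite c_lt ?mulr0 // kr' rn.
  - rewrite (_ : radical_frames k f = set0) ?cards0 ?mul0r //.
    apply/setP => A; rewrite in_set0; apply/negP => /radical_frames_rank.
    by rewrite leqNgt rk.
  - by case/eqP: kr; apply: val_inj.
under [RHS]eq_bigr => k _.
  under eq_bigr => j _ do rewrite -sum_radical_frame_pairs natr_sum mulr_sumr.
  rewrite exchange_big /=; over.
rewrite exchange_big /= (eq_bigr _ weight) -mulr_sumr -natr_sum.
congr (M * _%:R); rewrite -sum1_card big_mkcond [RHS]big_mkcond /=.
apply: eq_bigr => f _.
case: (boolP (f \in alternating_algebras)) => [fA|_]; last by case: ifP.
have /andP[-> _] : (f \in alternating_maps) &&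
  [forall x, forall y, forall z, f (f (x, y), z) == 0] by rewrite inE in fA.
by [].
Qed.
End Algebras.

(** * Bibraces and alternating algebras over F_2 *)

Section Bibraces.
Variable V : lmodType 'F_2.
Implicit Type mul circ : V -> V -> V.

Lemma F2_addvv (x : V) : x + x = 0.
Proof.
have two0 : 2%:R = 0 :> 'F_2 by apply: val_inj.
by rewrite -mulr2n -scaler_nat two0 scale0r.
Qed.

Lemma F2_addKv (x y : V) : x + (x + y) = y.
Proof. by rewrite addrA F2_addvv add0r. Qed.

Lemma F2_linear (g : V -> V) : {morph g : x y / x + y} -> linear g.
Proof.
move=> gD a x y; have g0 : g 0 = 0 by apply: (addrI (g 0)); rewrite -gD !addr0.
case: (altP (a =P 0)) => [->|a0]; first by rewrite !scale0r !add0r.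
suff -> : a = 1 by rewrite !scale1r gD.
by apply: val_inj; case: a a0 => [[|[|[]]]].
Qed.

Lemma add_elementary_abelian2 : elementary_abelian2 (+%R : V -> V -> V).
Proof.
exists 0, -%R; split.
- exact: addrA.
- exact: addrC.
- exact: add0r.
- exact: addNr.
- exact: F2_addvv.
Qed.

Lemma bibrace_alternating_algebra circ : binary_bibrace +%R circ ->
  binary_alternating_algebra (fun x y => x + y + circ x y).
Proof.
case=> _ [e [inv [cA cC c0 _ cxx]]] cDl cDr.
(* The first compatibility law at 0, 0, 0 reads [e = e + e], so both groups share their identity. *)
have e0 : e = 0 by have := cDl 0 0 0; rewrite !addr0 cxx F2_addvv.
rewrite {}e0 in c0 cxx.
pose mul x y := x + y + circ x y.
have circE x y : circ x y = x + y + mul x y by rewrite /mul F2_addKv.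
have mulC x y : mul x y = mul y x by rewrite /mul cC [x + y]addrC.
have mulDl x y z : mul (x + y) z = mul x z + mul y z.
  by rewrite /mul cDl (AC (3*3) ((1*3*4)*(2*5*6))).
have mulDr x y z : mul z (x + y) = mul z x + mul z y.
  by rewrite ![mul z _]mulC mulDl.
have mulxx x : mul x x = 0 by rewrite /mul cxx F2_addvv addr0.
(* This is what remains of the second compatibility law once [circ] is expanded; taking [y = 0] in
   it then kills the term [mul (mul x z) z]. *)
have mul2 x y z : mul (mul x z) y + mul (mul x z) z = 0.
  have := cDr x y z.
  have -> : circ (x + z) z = x + mul x z.
    by rewrite circE mulDl mulxx addr0 -[x + z + z]addrA F2_addvv addr0.
  rewrite !circE mulDl !mulDr => E.
  apply: (addrI (x + y + mul x y + z)); rewrite addr0 [RHS]E.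
  move: (mul (mul x z) y + _) => w.
  by rewrite [RHS](AC (2*2*(2*1)) ((2*6)*(1*3*5*4*7))) /= F2_addvv add0r.
have mul0r x : mul x 0 = 0 by rewrite /mul cC c0 addr0 F2_addvv.
have mul3 x y z : mul (mul x z) y = 0.
  by have := mul2 x y z; have := mul2 x 0 z; rewrite mul0r add0r => ->; rewrite addr0.
split=> [z|x|x|x y z].
- by apply: F2_linear => x y; apply: mulDl.
- by apply: F2_linear => y z; apply: mulDr.
- exact: mulxx.
- exact: mul3.
Qed.

Lemma alternating_algebra_bibrace mul : binary_alternating_algebra mul ->
  binary_bibrace +%R (fun x y => x + y + mul x y).
Proof.
case=> linl linr mulxx mul3.
have mulDl x y z : mul (x + y) z = mul x z + mul y z.
  by have := linl z 1 x y; rewrite !scale1r.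
have mulDr x y z : mul z (x + y) = mul z x + mul z y.
  by have := linr z 1 x y; rewrite !scale1r.
have mulC x y : mul x y = mul y x.
  have := mulxx (x + y); rewrite mulDl !mulDr !mulxx add0r addr0 => E.
  by apply: (addIr (mul y x)); rewrite E F2_addvv.
have mul0l x : mul 0 x = 0 by apply: (addrI (mul 0 x)); rewrite -mulDl !addr0.
have mul3' x y z : mul z (mul x y) = 0 by rewrite mulC mul3.
split; first exact: add_elementary_abelian2.
(* Associativity holds because both bracketings expand to the sum of x, y, z and their pairwise
   products, triple products being 0. Each element is its own inverse. *)
- exists 0, id; split.
  + move=> x y z; rewrite !mulDl !mulDr mul3 mul3' !addr0.
    by rewrite (AC (1*3*2) ((1*2*5)*3*(6*4))).
  + by move=> x y; rewrite mulC [x + y]addrC.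
  + by move=> x; rewrite mul0l add0r addr0.
  + by move=> x; rewrite mulxx F2_addvv addr0.
  + by move=> x; rewrite mulxx F2_addvv addr0.
- move=> x y z; rewrite mulDl; set a := mul x z; set b := mul y z.
  by rewrite [RHS](AC (3*1*3) ((4*6)*((1*5*2)*(3*7)))) /= F2_addvv add0r.
- move=> x y z.
  have -> : x + z + z + mul (x + z) z = x + mul x z.
    by rewrite mulDl mulxx addr0 -[x + z + z]addrA F2_addvv addr0.
  rewrite mulDl !mulDr !mul3 !addr0.
  by rewrite [RHS](AC (2*2*2) ((1*3*5*4)*(2*6))) /= F2_addvv addr0.
Qed.
End Bibraces.

(** * Evaluation of the counting formula over the integers in dimension 8 *)

Section Count.
Local Open Scope Z_scope.

(** [Z.max 0] reproduces the truncated subtraction of natural numbers in the frame counts. *)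
Definition frame_prodZ (k j r : nat) : Z :=
  foldr (fun i s => Z.max 0 (2 ^ Z.of_nat r - 2 ^ Z.of_nat (k + i)) * s) 1
    (iota 0 j).

Definition sumZ (m : nat) (G : nat -> Z) : Z :=
  foldr (fun j s => G j + s) 0 (iota 0 m).

(* The order of GL_8(2) times a power of 2 large enough for the division in
   [weight] to be exact whenever [k + j <= 8]. *)
Definition weight_denom : Z := 2 ^ 20 * frame_prodZ 0 8 8.

(* The q-binomial Moebius coefficients [(-1)^j 2^(j(j-1)/2)], divided by the
   orders of GL_k(2) and GL_j(2), because subspaces are counted by their bases,
   and by [2^(kj)], the number of lifts of a vector of the quotient by the
   span of the first basis, for each of the [j] vectors. *)
Definition weight (k j : nat) : Z :=
  (-1) ^ Z.of_nat j * 2 ^ Z.of_nat 'C(j, 2) * weight_denom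
    / (frame_prodZ 0 k k * frame_prodZ 0 j j * 2 ^ Z.of_nat (k * j)).
End Count.

Lemma natrZ m : m%:R = Z.of_nat m :> Z.
Proof. by elim: m => // m IHm; rewrite -addn1 natrD IHm; lia. Qed.

Lemma expnZ a m : Z.of_nat (a ^ m)%N = (Z.of_nat a ^ Z.of_nat m)%coqZ.
Proof.
elim: m => // m IHm; rewrite expnS Nat2Z.inj_succ Z.pow_succ_r; last by lia.
by rewrite -IHm; lia.
Qed.

Lemma frame_prodZE k j r :
  (\prod_(i < j) (2 ^ r - 2 ^ (k + i)))%N%:R = frame_prodZ k j r.
Proof.
rewrite natr_prod -(big_mkord xpredT (fun i => (2 ^ r - 2 ^ (k + i))%N%:R : Z)).
rewrite unlock /index_iota subn0 /frame_prodZ.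
elim: (iota 0 j) => //= i s ->; rewrite natrZ.
by congr (_ * _)%coqZ; rewrite Nat2Z.inj_sub_max !expnZ.
Qed.

Lemma sumZE m (G : nat -> Z) : \sum_(0 <= j < m) G j = sumZ m G.
Proof. by rewrite unlock /index_iota subn0. Qed.

Lemma card_alternating_algebras8 :
  #|alternating_algebras 'F_2 8|%:R = 117833335446016%coqZ :> Z.
Proof.
(* In dimension 8 the two hypotheses on the weights are finitely many integer identities, checked by
   evaluation. *)
have lt_check : all (fun r => all (fun k => 
    sumZ (9 - k) (fun j => weight k j * frame_prodZ k j r)%coqZ == 0)
    (iota 0 r)) (iota 0 9).
  by vm_compute.
have eq_check : all (fun k => weight_denom ==
    (sumZ (9 - k) (fun j => weight k j * frame_prodZ k j k)
      * frame_prodZ 0 k k)%coqZ) (iota 0 9).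
  by vm_compute.
have H := @card_alternating_algebras 'F_2 8 _ 2 weight_denom weight (card_Fp (isT : prime 2)).
(* The value here includes the zero product, hence exceeds the final count by one. *)
have {H} : weight_denom * #|alternating_algebras 'F_2 8|%:R =
    (weight_denom * 117833335446016)%coqZ.
  rewrite H => [|k r /andP[kr r8]|k k8].
  - rewrite sumZE.
    transitivity (sumZ 9 (fun k => sumZ (9 - k) (fun j => weight k j *
      (frame_prodZ 0 k 8 * frame_prodZ k j 8 * 2 ^ Z.of_nat (k * 'C(8 - (k + j), 2)))))%coqZ);
      last by vm_compute.
    congr (sumZ _ _); apply: funext => k; rewrite sumZE.
    congr (sumZ _ _); apply: funext => j.
    by rewrite !natrM -frame_prodZE -frame_prodZE [(2 ^ (_ * _))%N%:R]natrZ expnZ.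
  - rewrite sumZE; move/allP/(_ r): lt_check; rewrite mem_iota /= add0n => /(_ r8).
    move/allP/(_ k); rewrite mem_iota /= add0n => /(_ kr) /eqP <-.
    by congr (sumZ _ _); apply: funext => j; rewrite frame_prodZE.
  - move/allP/(_ k): eq_check; rewrite mem_iota /= add0n => /(_ k8) /eqP ->.
    rewrite sumZE -frame_prodZE; congr (sumZ _ _ * _).
    by apply: funext => j; rewrite frame_prodZE.
by move/Z.mul_reg_l; apply.
Qed.

(** * Nonzero products on F_2^8 and transport to bibraces *)

Local Notation V8 := 'rV['F_2]_8.

Lemma alternating_algebrasP (f : {ffun V8 * V8 -> V8}) :
  reflect (binary_alternating_algebra (fun x y => f (x, y)))
    (f \in alternating_algebras 'F_2 8).
Proof.
rewrite !inE; apply: (iffP andP).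
  case=> /asboolP[linl linr fxx] /forallP f3; split=> // x y z.
  by have /forallP/(_ y)/forallP/(_ z)/eqP := f3 x.
case=> linl linr fxx f3; split; first by apply/asboolP; split.
by apply/forallP => x; apply/forallP => y; apply/forallP => z; rewrite f3.
Qed.

Lemma alternating_algebras0 : [ffun=> 0] \in alternating_algebras 'F_2 8.
Proof.
apply/alternating_algebrasP.
by split=> [z a x y|x a y z|x|x y z]; rewrite !ffunE ?scaler0 ?addr0.
Qed.

Lemma nb_binops_alternating_algebra :
  nb_binops (fun mul : V8 -> V8 -> V8 =>
    binary_alternating_algebra mul /\ exists x y, mul x y <> 0)
  = #|alternating_algebras 'F_2 8 :\ [ffun=> 0]|.
Proof.
apply: eq_card => f; rewrite in_setD1 inE.
apply/asboolP/andP => [[fP [x [y fxy]]] | [f0 /alternating_algebrasP fP]].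
  split; last exact/alternating_algebrasP.
  by apply/eqP => f0; apply: fxy; rewrite f0 ffunE.
split=> //; apply: contrapT => fN; case/eqP: f0; apply/ffunP => -[x y].
by rewrite ffunE; apply: contrapT => fxy; apply: fN; exists x, y.
Qed.

Lemma nb_binops_bibrace_alternating_algebra :
  nb_binops (fun circ : V8 -> V8 -> V8 =>
    binary_bibrace +%R circ /\ ~ (circ =2 +%R))
  = nb_binops (fun mul : V8 -> V8 -> V8 =>
    binary_alternating_algebra mul /\ exists x y, mul x y <> 0).
Proof.
pose twist (f : {ffun V8 * V8 -> V8}) := [ffun s : V8 * V8 => s.1 + s.2 + f s].
have twistK : involutive twist.
  by move=> f; apply/ffunP => s; rewrite !ffunE F2_addKv.
have twistE f : (fun x y => twist f (x, y)) = (fun x y => x + y + f (x, y)).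
  by apply: funext => x; apply: funext => y; rewrite ffunE.
rewrite /nb_binops -[RHS](card_imset _ (inv_inj twistK)); apply: eq_card => f.
(* Writing [f] as [twist (twist f)] turns membership in the image into a condition on [twist f]. *)
rewrite -[f in RHS]twistK mem_imset; last exact: inv_inj.
rewrite !inE; congr asbool; rewrite propeqE twistE.
split=> [[fP fN]|[fP [x [y fxy]]]]; split.
- exact: bibrace_alternating_algebra.
- apply: contrapT => f0; apply: fN => x y.
  have : twist f (x, y) = 0 by apply: contrapT => fxy; apply: f0; exists x, y.
  rewrite ffunE /= => E; by rewrite -[LHS](F2_addKv (x + y)) E addr0.
- have := alternating_algebra_bibrace fP.
  congr (binary_bibrace _ _).
  by apply: funext => u; apply: funext => v; rewrite F2_addKv.
- by move=> f_add; apply: fxy; rewrite ffunE /= f_add F2_addvv.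
Qed.

(* The counts are compared in binary natural numbers because the value is too
   large for a unary literal. *)
Theorem mainTheorem2 :
  N.of_nat (nb_binops (fun circ : 'rV['F_2]_8 -> 'rV['F_2]_8 -> 'rV['F_2]_8 =>
      binary_bibrace +%R circ /\ ~ (circ =2 +%R)))
    = 117833335446015%num
  /\
  N.of_nat (nb_binops (fun mul : 'rV['F_2]_8 -> 'rV['F_2]_8 -> 'rV['F_2]_8 =>
      binary_alternating_algebra mul /\ exists x y, mul x y <> 0))
    = 117833335446015%num.
Proof.
have count : N.of_nat (nb_binops (fun mul : V8 -> V8 -> V8 =>
    binary_alternating_algebra mul /\ exists x y, mul x y <> 0))
    = 117833335446015%num.
  rewrite nb_binops_alternating_algebra.
  have := card_alternating_algebras8.
  rewrite natrZ (cardsD1 [ffun=> 0]) alternating_algebras0.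
  by move: #|_| => m; lia.
by rewrite nb_binops_bibrace_alternating_algebra.
Qed.
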